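(* Let $R=(r_1,r_2,\ldots,r_n)$ be a vector of nonnegative integers with $r_i=r_{n+1-i}$ for all $i$ such that $(r_1,\ldots,r_{\lfloor n/2\rfloor})$ is nondecreasing. If $n$ is even, assume that $$\sum_{i=1}^k r_i\ge k(k-1)\quad \left(k=1,2,\ldots,\frac{n}{2}\right),\ \mbox{ with equality for } k=\frac n2.$$ If $n$ is odd, assume that $$\sum_{i=1}^k r_i\ge k(k-1)+\left(k-\frac{r_{(n+1)/2}}{2}\right)^+\quad\left(k=1,2,\ldots,\frac{n-1}{2}\right),\ \mbox{ with equality if } k=\frac{n-1}{2}.$$ Then the skew-Hankel algorithm (defined in the context) applied to $R$ constructs a combinatorially skew-Hankel tournament with score vector $R$.
   Context: A combinatorially skew-Hankel tournament of order $n$ is an $n\times n$ $(0,1)$-matrix $T=[t_{ij}]$ such that $t_{ii}=t_{i,n+1-i}=0$ for all $i$, and, for all $i$ and all $j\ne i,n+1-i$, $t_{ji}=1-t_{ij}$ and $t_{n+1-j,n+1-i}=1-t_{ij}$. Its score vector is the vector of its row sums. For a number $a$, $a^+=\max\{0,a\}$. For a matrix $A$, $A^t$ denotes its transpose, and for an $m\times m$ matrix $A=[a_{ij}]$, $A^{th}$ denotes the matrix with $(i,j)$ entry $a_{m+1-i,m+1-j}$ (rotation by 180 degrees). $O$ denotes a zero matrix. Skew-Hankel algorithm (recursive; the order-$0$ output is the empty matrix). Input: $R=(r_1,\ldots,r_n)$ satisfying the hypotheses in the claim. (1) If $n$ is odd: (a) Let $v=(v_1,\ldots,v_n)$ be the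 $(0,1)$-vector such that, for $1\le i\le\frac{n-1}{2}$, $v_i=v_{n+1-i}=1$ if and only if $\frac{r_{(n+1)/2}}{2}+1\le i\le\frac{n-1}{2}$, and $v_{(n+1)/2}=0$. Let $R'_{n-1}=(r'_1,\ldots,r'_{n-1})$ with $r'_i=r'_{n-i}=r_i-v_i$ for $1\le i\le\frac{n-1}{2}$. (b) Let $Q_{n-1}$ be an $(n-1)\times(n-1)$ permutation matrix of the form $\left[\begin{array}{cc} P & O \\ O & P^{th} \end{array}\right]$, with $P$ an $\frac{n-1}{2}\times\frac{n-1}{2}$ permutation matrix, such that the first half of $R_{n-1}=R'_{n-1}Q_{n-1}^t$ is nondecreasing. (c) Let $T_{n-1}$ be obtained by applying this algorithm to $R_{n-1}$, and write $T'_{n-1}=Q_{n-1}^tT_{n-1}Q_{n-1}=\left[\begin{array}{cc} A & B \\ B^{th} & A^{th} \end{array}\right]$. (d) Let $T_n$ be obtained from $T'_{n-1}$ by inserting a new middle row and middle column (index $\frac{n+1}{2}$), where the middle column is $(v_1,\ldots,v_{(n-1)/2},0,v_{(n+3)/2},\ldots,v_n)^t$ and the middle row is $(1-v_1,\ldots,1-v_{(n-1)/2},0,1-v_{(n+3)/2},\ldots,1-v_n)$. (2) If $n$ is even: (a) Let $v=(v_1,\ldots,v_n)$ be the $(0,1)$-vector with $v_i=1$ if and only if $2+\lceil\frac{r_1}{2}\rceil\le i\le n-1-\lfloor\frac{r_1}{2}\rfloor$. Let $R'_{n-2}=(r'_1,\ldots,r'_{n-2})$ with $r'_i=r_{i+1}-v_{i+1}-v_{n-i}$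 for $1\le i\le n-2$. (b) Let $Q_{n-2}$ be an $(n-2)\times(n-2)$ permutation matrix of the form $\left[\begin{array}{cc} P & O \\ O & P^{th} \end{array}\right]$, with $P$ an $\frac{n-2}{2}\times\frac{n-2}{2}$ permutation matrix, such that the first half of $R_{n-2}=R'_{n-2}Q_{n-2}^t$ is nondecreasing (so $R_{n-2}$ is palindromic). (c) Let $T_{n-2}$ be obtained by applying this algorithm to $R_{n-2}$, and let $T_n$ be the $n\times n$ matrix whose first row is $(0,1-v_{n-1},\ldots,1-v_2,0)$, whose first column is $(0,v_{n-1},\ldots,v_2,0)^t$, whose last column is $(0,v_2,\ldots,v_{n-1},0)^t$, whose last row is $(0,1-v_2,\ldots,1-v_{n-1},0)$, and whose central $(n-2)\times(n-2)$ submatrix (rows and columns $2,\ldots,n-1$) is $Q_{n-2}^tT_{n-2}Q_{n-2}$. (3) Output $T_n$.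
   Formalization: For n odd, the assumption that the middle entry r_{(n+1)/2} is at most n-1 is added; without it the claim fails, e.g. for n=1, R=(1) or n=3, R=(0,100,0), and the bound is necessary for any score vector of order n. *)

(* Defs.v *)
From HB Require Import structures.
From mathcomp Require Import all_boot all_order all_algebra.

Set Implicit Arguments.
Unset Strict Implicit.
Unset Printing Implicit Defensive.

Import Order.TTheory GRing.Theory Num.Theory.
Local Open Scope ring_scope.

(* Indices are 0-based: the mathematical index i of {1, ..., n} is the ordinal
   of value i - 1, and n + 1 - i becomes [rev_ord].  (0,1)-matrices and integer
   vectors are matrices over [int], so that subtraction is not truncated. *)

Definition skew_hankel_tournament (n : nat) (T : 'M[int]_n) : Prop :=
  [/\ forall i j, T i j = 0 \/ T i j = 1,
      forall i, T i i = 0 /\ T i (rev_ord i) = 0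
    & forall i j, j != i -> j != rev_ord i ->
        T j i = 1 - T i j /\ T (rev_ord j) (rev_ord i) = 1 - T i j].

Definition score_vector (n : nat) (T : 'M[int]_n) : 'rV[int]_n :=
  \row_i \sum_j T i j.

Definition palindromic (n : nat) (R : 'rV[int]_n) : Prop :=
  forall i, R 0 i = R 0 (rev_ord i).

Definition nondecreasing_half (n : nat) (R : 'rV[int]_n) : Prop :=
  forall i j : 'I_n, (i <= j)%N -> (j < n./2)%N -> R 0 i <= R 0 j.

Definition pospart (a : rat) : rat := Num.max 0 a.

Definition partial_sum (n : nat) (R : 'rV[int]_n) (k : nat) : rat :=
  (\sum_(i < n | (i < k)%N) R 0 i)%:~R.

(* As n./2 is n/2 for even n and (n-1)/2 for odd n, both cases of the
   hypothesis are instances of this one with different bounds. *)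
Definition partial_sums_ge (n : nat) (R : 'rV[int]_n) (bound : nat -> rat) :
    Prop :=
  forall k : nat, (1 <= k <= n./2)%N ->
    bound k <= partial_sum R k /\ (k = n./2 -> partial_sum R k = bound k).

Definition rot180 (m : nat) (A : 'M[int]_m) : 'M[int]_m :=
  \matrix_(i, j) A (rev_ord i) (rev_ord j).

Definition block_th (h : nat) (P : 'M[int]_h) : 'M[int]_(h + h) :=
  block_mx P 0 0 (rot180 P).

Definition mid (h : nat) : 'I_(h + h).+1 := inord h.

(* [minn i.+1 (n - i)] is whichever of the 1-based indices i and n + 1 - i is
   at most (n + 1)/2; it equals h + 1, giving v = 0, at the middle index. *)
Definition odd_v (h : nat) (R : 'rV[int]_(h + h).+1) : 'rV[int]_(h + h).+1 :=
  \row_(i < (h + h).+1)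
    let k := minn i.+1 ((h + h).+1 - i) in
    (((R 0 (mid h))%:~R / 2 + 1 <= k%:R :> rat) && (k <= h)%N)%:R.

Definition odd_residual (h : nat) (R : 'rV[int]_(h + h).+1) :
    'rV[int]_(h + h) :=
  \row_(i < h + h)
    let k := inord (minn i (rev_ord i)) in R 0 k - odd_v R 0 k.

Definition insert_middle (n : nat) (c : 'I_n.+1) (v : 'rV[int]_n.+1)
    (M : 'M[int]_n) : 'M[int]_n.+1 :=
  \matrix_(i, j)
    match unlift c i, unlift c j with
    | Some a, Some b => M a b
    | Some _, None => v 0 i
    | None, Some _ => 1 - v 0 j
    | None, None => 0
    end.

(* [inner] sends the 1-based index i to i + 1, and [uninner] is its partial
   inverse, undefined exactly on the first and last indices. *)
Definition inner (m : nat) (i : 'I_m) : 'I_m.+2 := lift ord0 (lift ord_max i).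

Definition uninner (m : nat) (i : 'I_m.+2) : option 'I_m :=
  obind (unlift ord_max) (unlift ord0 i).

Definition even_v (m : nat) (R : 'rV[int]_m.+2) : 'rV[int]_m.+2 :=
  let r1 : rat := (R 0 ord0)%:~R in
  \row_(i < m.+2)
    ((2 + Num.ceil (r1 / 2) <= i.+1%:Z) &&
     (i.+1%:Z <= m.+2%:Z - 1 - Num.floor (r1 / 2)))%:R.

Definition even_residual (m : nat) (R : 'rV[int]_m.+2) : 'rV[int]_m :=
  \row_(i < m) (R 0 (inner i) - even_v R 0 (inner i)
                - even_v R 0 (rev_ord (inner i))).

Definition add_border (m : nat) (v : 'rV[int]_m.+2) (M : 'M[int]_m) :
    'M[int]_m.+2 :=
  \matrix_(i, j)
    match uninner i, uninner j with
    | Some a, Some b => M a b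
    | Some _, None => if j == ord0 then v 0 (rev_ord i) else v 0 i
    | None, Some _ => if i == ord0 then 1 - v 0 (rev_ord j) else 1 - v 0 j
    | None, None => 0
    end.

(* [skew_hankel_alg R T]: some run of the algorithm on input R outputs T.  It
   is a relation because the permutation matrix P sorting the first half of the
   residual vector need not be unique. *)
Inductive skew_hankel_alg : forall n : nat, 'rV[int]_n -> 'M[int]_n -> Prop :=
| alg_empty (R : 'rV[int]_0) : skew_hankel_alg R 0
| alg_odd (h : nat) (R : 'rV[int]_(h + h).+1) (P : 'M[int]_h)
    (T : 'M[int]_(h + h)) :
    let Q := block_th P in
    let R' := odd_residual R *m Q^T in
    is_perm_mx P -> nondecreasing_half R' -> skew_hankel_alg R' T ->
    skew_hankel_alg R (insert_middle (mid h) (odd_v R) (Q^T *m T *m Q))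
| alg_even (h : nat) (R : 'rV[int]_(h + h).+2) (P : 'M[int]_h)
    (T : 'M[int]_(h + h)) :
    let Q := block_th P in
    let R' := even_residual R *m Q^T in
    is_perm_mx P -> nondecreasing_half R' -> skew_hankel_alg R' T ->
    skew_hankel_alg R (add_border (even_v R) (Q^T *m T *m Q)).

(* Main.v *)
Require Import Defs.
From mathcomp Require Import all_boot all_order all_fingroup all_algebra.
From mathcomp Require Import zify lra.
Set Implicit Arguments.
Unset Strict Implicit.
Unset Printing Implicit Defensive.
Import Order.TTheory GRing.Theory Num.Theory.
Local Open Scope ring_scope.

(** The algorithm peels off the middle line (odd order) or the two outer lines
    (even order), so the proof is an induction along a run of the algorithm,
    and two things have to be checked at each step.

    Rebuilding is formal.  Conjugation by Q relabels the vertices by a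
    permutation that commutes with i |-> n + 1 - i ([block_th_perm]), so it
    preserves tournaments and permutes their scores ([tournament_conj],
    [score_conj]).  The new lines are a 0-1 vector v and its complement; they
    give a tournament ([tournament_insert_middle], [tournament_add_border]),
    whose old vertices gain exactly what the residual vector lost, and whose
    new vertices have the prescribed scores because v has the right number of
    ones ([score_insert_middle], [score_add_border]).

    The real point is that the sorted residual vector satisfies the Landau-type
    condition of the smaller even order: its first k entries sum to at least
    k(k-1), with equality at the half.  For the unsorted residual this is a
    direct computation: the prefix sums of v over the first half are
    (k - m)^+ when the middle score is 2m, and, in the even case, those of v
    plus its reversal are (2k - a)^+ when the first score is a.  Sorting could
    lower a prefix sum, so a bound on the sums over all k-subsets is needed;
    [subset_sums_ge] deduces it from the bound on prefixes, using only that the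
    residual r' is within 2 below a nondecreasing vector r.  Indeed let S be a
    violating set of least size k.  Deleting its largest entry leaves a
    non-violating set, so that entry, hence every entry of r' on S, is at most
    2k - 3, and r is at most 2k - 1 on S.  The indices with r at most 2k - 1
    form a prefix of some length q containing S, and the q - k additional
    indices contribute at most 2k - 1 each, whereas q(q-1) - k(k-1) is at least
    2k(q - k); so the prefix of length q would already violate the bound.

    A run exists on every input, since a vector can always be sorted
    ([alg_has_run]). *)

(** * Prefix sums and subset sums *)

Lemma PoszM_pred k : (k * k.-1)%N%:Z = k%:Z * (k%:Z - 1).
Proof. by case: k => [|k]; lia. Qed.

Lemma half_addnn h : (h + h)./2 = h.
Proof. by rewrite addnn doubleK. Qed.

Lemma uphalf_addnn h : uphalf (h + h) = h.
Proof. by rewrite addnn uphalf_double. Qed.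

Lemma bool01 (b : bool) : b%:R = 0 :> int \/ b%:R = 1 :> int.
Proof. by case: b; [right|left]. Qed.

(** The map [g] is the inclusion of initial segments; leaving it abstract lets
    the several embeddings of the first half ([lshift], [lift (mid h)], [inord])
    be used without casts. *)
Lemma sum_prefix (V : nmodType) n m (g : 'I_m -> 'I_n) (F : 'I_n -> V) k :
    (forall i, g i = i :> nat) -> (k <= m <= n)%N ->
  \sum_(i < n | (i < k)%N) F i = \sum_(i < m | (i < k)%N) F (g i).
Proof.
move=> g_val /andP[km mn].
rewrite (eq_bigl (fun i : 'I_n => (i < k)%N && (i < m)%N)); last first.
  by move=> i /=; case: ltnP => //= ik; rewrite (leq_trans ik km).
rewrite (big_ord_narrow_cond mn) /=.
by apply: eq_bigr => i _; congr F; apply: val_inj; rewrite /= g_val.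
Qed.

Lemma sum_prefix_full (V : nmodType) h (F : 'I_h -> V) :
  \sum_(i < h | (i < h)%N) F i = \sum_i F i.
Proof. by apply: eq_bigl => i; rewrite ltn_ord. Qed.

Lemma sum_indicator_ge h k c : (k <= h)%N ->
  \sum_(i < h | (i < k)%N) (c <= i)%N%:R = (k - c)%N%:Z.
Proof.
move=> kh; rewrite (@sum_prefix int h k (widen_ord kh)) ?leqnn //=.
rewrite sum_prefix_full.
elim: {kh}k => [|k IH]; first by rewrite big_ord0.
by rewrite big_ord_recr /= IH; lia.
Qed.

Lemma card_prefix h k : (k <= h)%N -> #|[set i : 'I_h | (i < k)%N]| = k.
Proof.
move=> kh; rewrite -sum1_card; under eq_bigl do rewrite inE.
rewrite (@sum_prefix nat h k (widen_ord kh)) ?leqnn //=.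
under eq_bigl do rewrite ltn_ord.
by rewrite sum1_card card_ord.
Qed.

(** Minimal counterexample: in a violating set of least size the entries are
    small, and all indices with such small entries make a violating prefix.
    The constant 2 is the most that two copies of a 0-1 vector can take away
    from an entry. *)
Lemma subset_sums_ge h (r r' : 'I_h -> int) :
    (forall i j : 'I_h, (i <= j)%N -> r i <= r j) ->
    (forall i, r' i <= r i <= r' i + 2) ->
    (forall k, (k <= h)%N -> (k * k.-1)%N%:Z <= \sum_(i < h | (i < k)%N) r' i) ->
  forall S : {set 'I_h}, (#|S| * #|S|.-1)%N%:Z <= \sum_(i in S) r' i.
Proof.
move=> r_mono r_r' prefix_ge S.
move: {2}#|S| (erefl #|S|) => k; elim: k S => [|k IH] S cardS.
  by rewrite cardS (cards0_eq cardS) big_set0.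
rewrite leNgt; apply/negP => ltS.
have /card_gt0P[x0 x0S] : (0 < #|S|)%N by rewrite cardS.
have [x xS x_max] := Order.TotalTheory.arg_maxP r' x0S.
have {}xS : x \in S := xS.
(* Otherwise S without x would violate the bound too. *)
have r'x_le : r' x <= (k.*2)%:Z - 1.
  have cardSx : #|S :\ x| = k.
    by apply/succn_inj; rewrite -cardS (cardsD1 x S) xS.
  move: ltS (IH _ cardSx).
  rewrite (big_setD1 x xS) /= cardS cardSx !PoszM_pred.
  move: (\sum_(i in _) _); clear; nia.
(* Here k.*2 + 1 is 2 #|S| - 1, since #|S| is k.+1. *)
pose U := [set i | r i <= (k.*2)%:Z + 1].
have SU : S \subset U.
  apply/subsetP => i iS; rewrite inE.
  by have := x_max i iS; have /andP[_] := r_r' i; lia.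
pose q := \max_(i in U) i.+1.
have qh : (q <= h)%N by apply/bigmax_leqP.
have defU i : (i \in U) = (i < q)%N.
  apply/idP/idP => [iU|]; first
    exact: (@leq_bigmax_cond _ _ (fun i : 'I_h => i.+1) i).
  apply: contraLR => iU; rewrite -leqNgt; apply/bigmax_leqP => j jU.
  rewrite ltnNge; apply: contra iU => ij; move: jU; rewrite !inE.
  exact: le_trans (r_mono _ _ ij).
have cardU : #|U| = q.
  by rewrite -[RHS](card_prefix qh); apply: eq_card => i; rewrite defU inE.
have := prefix_ge q qh.
rewrite (eq_bigl (mem U)) => [|i]; last by rewrite /= -defU.
rewrite (big_setID S) /= (setIidPr SU) => leU.
have leUS : \sum_(i in U :\: S) r' i <= ((k.*2)%:Z + 1) *+ #|U :\: S|.
  rewrite -sumr_const; apply: ler_sum => i; rewrite !inE => /andP[_].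
  by have /andP[+ _] := r_r' i; lia.
have := cardsD U S; rewrite (setIidPr SU) cardS cardU => cardUS.
have := subset_leq_card SU; rewrite cardS cardU => kq.
move: leUS; rewrite -mulr_natr cardUS; move: ltS leU; rewrite cardS !PoszM_pred.
set s := \sum_(i in S) _; set u := \sum_(i in _) _.
have -> : (q - k.+1)%N%:R = q%:Z - k%:Z - 1 by lia.
move: kq; move: s u q {cardUS cardU defU qh} => s u q; clear; nia.
Qed.

(** * Permutations that commute with reversal *)

Lemma rev_ord_rshift h (b : 'I_h) : rshift h b = rev_ord (lshift h (rev_ord b)).
Proof. by apply: val_inj => /=; have := ltn_ord b; lia. Qed.

Lemma rev_ord_lshift h (b : 'I_h) : rev_ord (lshift h b) = rshift h (rev_ord b).
Proof. by rewrite rev_ord_rshift rev_ordK. Qed.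

Lemma sum_half (V : nmodType) h (F : 'I_(h + h) -> V) :
  \sum_i F i = \sum_(i < h) (F (lshift h i) + F (rev_ord (lshift h i))).
Proof.
rewrite big_split_ord big_split /=; congr (_ + _).
rewrite (reindex_inj rev_ord_inj) /=.
by apply: eq_bigr => i _; rewrite rev_ord_lshift.
Qed.

(** The function behind the block matrix diag(P, P^th) when P is the matrix of
    [s]. *)
Definition sym_perm_fun h (s : 'S_h) (i : 'I_(h + h)) : 'I_(h + h) :=
  match split i with
  | inl a => lshift h (s a)
  | inr b => rev_ord (lshift h (s (rev_ord b)))
  end.

Lemma sym_perm_fun_lshift h (s : 'S_h) a :
  sym_perm_fun s (lshift h a) = lshift h (s a).
Proof. by rewrite /sym_perm_fun (unsplitK (inl a)). Qed.

Lemma sym_perm_fun_rev h (s : 'S_h) i :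
  sym_perm_fun s (rev_ord i) = rev_ord (sym_perm_fun s i).
Proof.
have [a ->|b ->] := split_ordP i.
  rewrite rev_ord_lshift /sym_perm_fun (unsplitK (inr _)) (unsplitK (inl _)).
  by rewrite rev_ordK.
rewrite rev_ord_rshift rev_ordK sym_perm_fun_lshift -rev_ord_rshift.
by rewrite /sym_perm_fun (unsplitK (inr _)) rev_ordK.
Qed.

Lemma sym_perm_fun_inj h (s : 'S_h) : injective (sym_perm_fun s).
Proof.
apply: (can_inj (g := sym_perm_fun (s^-1)%g)) => i.
have [a ->|b ->] := split_ordP i; first by rewrite !sym_perm_fun_lshift permK.
by rewrite rev_ord_rshift !sym_perm_fun_rev !sym_perm_fun_lshift permK.
Qed.

Definition sym_perm h (s : 'S_h) : 'S_(h + h) := perm (@sym_perm_fun_inj h s).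

Lemma sym_perm_lshift h (s : 'S_h) a :
  sym_perm s (lshift h a) = lshift h (s a).
Proof. by rewrite permE sym_perm_fun_lshift. Qed.

Lemma sym_perm_rev h (s : 'S_h) i :
  sym_perm s (rev_ord i) = rev_ord (sym_perm s i).
Proof. by rewrite !permE sym_perm_fun_rev. Qed.

Lemma block_th_perm h (s : 'S_h) :
  block_th (perm_mx s) = perm_mx (sym_perm s).
Proof.
apply/matrixP => i j; rewrite /block_th.
have [a ->|b ->] := split_ordP i; have [c ->|d ->] := split_ordP j;
  rewrite ?(block_mxEul, block_mxEur, block_mxEdl, block_mxEdr) !mxE.
- by rewrite sym_perm_lshift (inj_eq (@lshift_inj _ _)).
- by rewrite sym_perm_lshift eq_lrshift.
- rewrite rev_ord_rshift sym_perm_rev sym_perm_lshift rev_ord_lshift.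
  by rewrite eq_rlshift.
- rewrite !rev_ord_rshift sym_perm_rev sym_perm_lshift (inj_eq rev_ord_inj).
  by rewrite (inj_eq (@lshift_inj _ _)).
Qed.

Lemma mul_row_tr_perm n (X : 'rV[int]_n) (s : 'S_n) i :
  (X *m (perm_mx s)^T) 0 i = X 0 (s i).
Proof. by rewrite tr_perm_mx -col_permE mxE. Qed.

Lemma conj_perm_mxE n (T : 'M[int]_n) (s : 'S_n) i j :
  ((perm_mx s)^T *m T *m perm_mx s) i j = T ((s^-1)%g i) ((s^-1)%g j).
Proof.
by rewrite tr_perm_mx -row_permE -{2}[s]invgK -col_permE !mxE.
Qed.

Lemma exists_sorting_perm h (f : 'I_h -> int) :
  exists s : 'S_h, forall i j : 'I_h, (i <= j)%N -> f (s i) <= f (s j).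
Proof.
pose t := [tuple f i | i < h].
have st : perm_eq (sort_tuple <=%R t) t by rewrite /= perm_sort.
have /tuple_permP[s sE] := st.
exists s => i j ij.
have nthE (k : 'I_h) : f (s k) = nth 0 (sort <=%R t) k.
  rewrite -[sort _ _]/(tval (sort_tuple <=%R t)) sE.
  rewrite -(tnth_nth 0 [tuple tnth t (s i) | i < h] k).
  by rewrite !tnth_mktuple.
rewrite !nthE; apply: (sorted_leq_nth le_trans) => //.
- exact/sort_sorted/le_total.
- by rewrite inE size_sort size_tuple.
- by rewrite inE size_sort size_tuple.
Qed.

Lemma exists_sorting_block h (X : 'rV[int]_(h + h)) :
  exists s : 'S_h, nondecreasing_half (X *m (block_th (perm_mx s))^T).
Proof.
have [s s_sorts] := exists_sorting_perm (fun i => X 0 (lshift h i)).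
exists s; rewrite block_th_perm => i j.
rewrite half_addnn => ij jh; rewrite !mul_row_tr_perm.
have ih := leq_ltn_trans ij jh.
have -> : i = lshift h (Ordinal ih) by apply: ord_inj.
have -> : j = lshift h (Ordinal jh) by apply: ord_inj.
by rewrite !sym_perm_lshift; apply: s_sorts.
Qed.

(** * Building tournaments *)

Lemma tournament_conj h (T : 'M[int]_(h + h)) (s : 'S_h) :
    let Q := block_th (perm_mx s) in
  skew_hankel_tournament T -> skew_hankel_tournament (Q^T *m T *m Q).
Proof.
move=> Q [T01 Tdiag Tskew]; rewrite {}/Q block_th_perm.
set t := sym_perm s.
have t_rev i : (t^-1)%g (rev_ord i) = rev_ord ((t^-1)%g i).
  by apply: (@perm_inj _ t); rewrite sym_perm_rev !permKV.
split=> [i j|i|i j ij irj]; rewrite !conj_perm_mxE ?t_rev //.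
by apply: Tskew; rewrite -?t_rev (inj_eq perm_inj).
Qed.

Lemma score_conj h (T : 'M[int]_(h + h)) (X : 'rV[int]_(h + h)) (s : 'S_h) :
    let Q := block_th (perm_mx s) in
  score_vector T = X *m Q^T -> score_vector (Q^T *m T *m Q) = X.
Proof.
rewrite block_th_perm => /= /rowP scoreT; apply/rowP => i; rewrite mxE.
under eq_bigr do rewrite conj_perm_mxE.
have := scoreT (((sym_perm s)^-1)%g i).
rewrite mul_row_tr_perm permKV mxE => <-.
by rewrite [RHS](reindex_inj (@perm_inj _ ((sym_perm s)^-1)%g)).
Qed.

Lemma val_mid h : mid h = h :> nat.
Proof. by rewrite inordK // ltnS leq_addr. Qed.

Lemma lift_mid_lshift h (a : 'I_h) : lift (mid h) (lshift h a) = a :> nat.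
Proof. by rewrite /= val_mid /bump leqNgt ltn_ord. Qed.

Lemma lift_mid_rev h (a : 'I_(h + h)) :
  lift (mid h) (rev_ord a) = rev_ord (lift (mid h) a).
Proof.
apply: val_inj => /=; rewrite /bump inordK ?ltnS ?leq_addr //.
by have := ltn_ord a; lia.
Qed.

Lemma rev_mid h : rev_ord (mid h) = mid h.
Proof. by apply: val_inj; rewrite /= inordK ?ltnS ?leq_addr; lia. Qed.

(** Reversal fixes the middle index, so the two skewness conditions on an
    entry of the middle line agree exactly when [v] is palindromic. *)
Lemma tournament_insert_middle h (v : 'rV[int]_(h + h).+1) M :
    (forall i, v 0 i = 0 \/ v 0 i = 1) -> palindromic v ->
  skew_hankel_tournament M -> skew_hankel_tournament (insert_middle (mid h) v M).
Proof.
move=> v01 v_pal [M01 Mdiag Mskew].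
split=> [i j|i|i j].
- case: (unliftP (mid h) i) => [a ->|->];
    case: (unliftP (mid h) j) => [b ->|->]; rewrite mxE ?liftK ?unlift_none //.
    by case: (v01 (lift (mid h) b)) => ->; [right|left].
  by left.
- case: (unliftP (mid h) i) => [a ->|->]; rewrite !mxE.
    by rewrite -lift_mid_rev !liftK; apply: Mdiag.
  by rewrite rev_mid unlift_none.
- case: (unliftP (mid h) i) => [a ->|->]; case: (unliftP (mid h) j) => [b ->|->].
  + rewrite -lift_mid_rev !(inj_eq lift_inj) => ba bra.
    by rewrite !mxE -!lift_mid_rev !liftK; apply: Mskew.
  + move=> _ _; rewrite !mxE rev_mid -!lift_mid_rev !liftK unlift_none.
    by rewrite lift_mid_rev -v_pal.
  + move=> _ _; rewrite !mxE rev_mid -!lift_mid_rev !liftK unlift_none.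
    by rewrite lift_mid_rev -v_pal; split; lia.
  + by rewrite eqxx.
Qed.

Lemma uninner_inner m (i : 'I_m) : uninner (inner i) = Some i.
Proof. by rewrite /uninner /inner liftK /= liftK. Qed.

Lemma uninner0 m : uninner (ord0 : 'I_m.+2) = None.
Proof. by rewrite /uninner unlift_none. Qed.

Lemma uninner_max m : uninner (ord_max : 'I_m.+2) = None.
Proof.
have -> : (ord_max : 'I_m.+2) = lift ord0 ord_max by apply: val_inj.
by rewrite /uninner liftK /= unlift_none.
Qed.

Lemma innerE m (i : 'I_m) : inner i = i.+1 :> nat.
Proof. by rewrite /inner lift0 lift_max. Qed.

Lemma rev_inner m (i : 'I_m) : rev_ord (inner i) = inner (rev_ord i).
Proof.
by apply: ord_inj; rewrite innerE /= /bump; have := ltn_ord i; lia.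
Qed.

Lemma inner_inj m : injective (@inner m).
Proof. by move=> i j /lift_inj/lift_inj. Qed.

Variant border_spec m : 'I_m.+2 -> Prop :=
| BorderFirst : border_spec ord0
| BorderLast : border_spec ord_max
| BorderInner a : border_spec (inner a).

Lemma borderP m (i : 'I_m.+2) : border_spec i.
Proof.
case: (unliftP ord0 i) => [k ->|->]; last exact: BorderFirst.
case: (unliftP ord_max k) => [a ->|->]; first exact: (BorderInner a).
suff -> : lift ord0 ord_max = ord_max :> 'I_m.+2 by apply: BorderLast.
exact: val_inj.
Qed.

Lemma rev_ord0 m : rev_ord (ord0 : 'I_m.+1) = ord_max.
Proof. by apply: val_inj => /=; lia. Qed.

Lemma rev_ord_max m : rev_ord (ord_max : 'I_m.+1) = ord0.
Proof. by apply: val_inj => /=; lia. Qed.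

Lemma sum_border (V : nmodType) m (F : 'I_m.+2 -> V) :
  \sum_i F i = F ord0 + \sum_i F (inner i) + F ord_max.
Proof.
rewrite big_ord_recl big_ord_recr /= addrA; congr (_ + _ + F _); last first.
  exact: val_inj.
by apply: eq_bigr => i _; congr F; apply: ord_inj; rewrite /= /bump; have := ltn_ord i; lia.
Qed.

Lemma add_border_inner_first m (v : 'rV[int]_m.+2) M b :
  add_border v M (inner b) ord0 = v 0 (rev_ord (inner b)).
Proof. by rewrite mxE uninner_inner uninner0 eqxx. Qed.

Lemma add_border_inner_last m (v : 'rV[int]_m.+2) M b :
  add_border v M (inner b) ord_max = v 0 (inner b).
Proof. by rewrite mxE uninner_inner uninner_max. Qed.

(** Reversal exchanges the two outer lines, and the second one is built as the
    mirror image of the first, so skewness holds by construction. *)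
Lemma tournament_add_border m (v : 'rV[int]_m.+2) M :
    (forall i, v 0 i = 0 \/ v 0 i = 1) ->
  skew_hankel_tournament M -> skew_hankel_tournament (add_border v M).
Proof.
move=> v01 [M01 Mdiag Mskew].
have v01' i : 1 - v 0 i = 0 \/ 1 - v 0 i = 1.
  by case: (v01 i) => ->; [right|left].
have max_neq0 : (ord_max == ord0 :> 'I_m.+2) = false by [].
pose E := (uninner0, uninner_max, uninner_inner, rev_ord0, rev_ord_max,
  rev_inner, rev_ordK, eqxx, max_neq0).
split=> [i j|i|i j].
- rewrite mxE; case: (borderP i) => [||a]; case: (borderP j) => [||b];
    by rewrite !E; auto.
- by case: (borderP i) => [||a]; rewrite !mxE !E; auto.
- case: (borderP i) => [||a]; case: (borderP j) => [||b]; rewrite ?E // => ij irj;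
    rewrite !mxE !E; try by split; lia.
  by apply: Mskew; [move: ij|move: irj]; rewrite (inj_eq (@inner_inj _)).
Qed.

(** * Scores in the odd step *)

Lemma odd_v_pal h (R : 'rV[int]_(h + h).+1) : palindromic (odd_v R).
Proof.
move=> i; rewrite !mxE.
suff -> : minn (rev_ord i).+1 ((h + h).+1 - rev_ord i) =
          minn i.+1 ((h + h).+1 - i) by [].
by rewrite /=; have := ltn_ord i; lia.
Qed.

Lemma odd_v01 h (R : 'rV[int]_(h + h).+1) i : odd_v R 0 i = 0 \/ odd_v R 0 i = 1.
Proof. by rewrite mxE; apply: bool01. Qed.

Lemma odd_v_lshift h (R : 'rV[int]_(h + h).+1) (m : nat) (a : 'I_h) :
    R 0 (mid h) = (m.*2)%:Z ->
  odd_v R 0 (lift (mid h) (lshift h a)) = (m <= a)%N%:R.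
Proof.
move=> Rmid; rewrite mxE lift_mid_lshift Rmid; have ah := ltn_ord a.
have -> : minn a.+1 ((h + h).+1 - a) = a.+1 by lia.
rewrite /= ah andbT; congr (nat_of_bool _)%:R.
rewrite -mul2n PoszM rmorphM /= mulrAC divff // mul1r.
by rewrite -[m%:~R]/(m%:R) -[1]/(1%:R) -natrD ler_nat addn1.
Qed.

(** The residual is defined by folding indices onto the first half; for a
    palindromic input this is the plain difference. *)
Lemma odd_residualE h (R : 'rV[int]_(h + h).+1) a : palindromic R ->
  odd_residual R 0 a = R 0 (lift (mid h) a) - odd_v R 0 (lift (mid h) a).
Proof.
move=> R_pal; rewrite mxE.
have [b ->|b ->] := split_ordP a.
  suff -> : inord (minn (lshift h b) (rev_ord (lshift h b))) =
            lift (mid h) (lshift h b) by [].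
  apply: ord_inj; rewrite lift_mid_lshift inordK /=; have := ltn_ord b; lia.
rewrite rev_ord_rshift rev_ordK lift_mid_rev -R_pal -odd_v_pal.
suff -> : inord (minn (rev_ord (lshift h (rev_ord b))) (lshift h (rev_ord b))) =
          lift (mid h) (lshift h (rev_ord b)) by [].
apply: ord_inj; rewrite lift_mid_lshift inordK /=; have := ltn_ord b; lia.
Qed.

(** The middle vertex beats the vertices where [odd_v] vanishes, which are the
    first m and, by symmetry, the last m. *)
Lemma score_insert_middle h (R : 'rV[int]_(h + h).+1) (m : nat) M :
    palindromic R -> (m <= h)%N -> R 0 (mid h) = (m.*2)%:Z ->
    score_vector M = odd_residual R ->
  score_vector (insert_middle (mid h) (odd_v R) M) = R.
Proof.
move=> R_pal mh Rmid /rowP scoreM; apply/rowP => i; rewrite mxE.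
rewrite (bigD1_ord (mid h)) //= mxE unlift_none.
case: (unliftP (mid h) i) => [a ->|->].
  under eq_bigr do rewrite mxE !liftK.
  by have := scoreM a; rewrite mxE odd_residualE // => ->; rewrite addrC subrK.
rewrite add0r Rmid.
under eq_bigr do rewrite mxE unlift_none liftK.
rewrite sum_half; under eq_bigr => k _.
  rewrite lift_mid_rev -odd_v_pal (odd_v_lshift _ Rmid).
  rewrite -mulr2n mulrnBl; over.
rewrite sumrB !sumrMnl sumr_const card_ord.
have -> : \sum_(i < h) (m <= i)%N%:R = (h - m)%N%:Z.
  by rewrite -sum_prefix_full sum_indicator_ge.
by lia.
Qed.

(** * Scores in the even step *)

Lemma even_vE m (R : 'rV[int]_m.+2) (a : nat) i : R 0 ord0 = a%:Z ->
  even_v R 0 i = ((uphalf a < i)%N && (i + a./2 <= m)%N)%:R.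
Proof.
move=> Ra; rewrite mxE Ra.
have a2 : (a%:~R : rat) = (odd a)%:R + (a./2)%:R * 2.
  by rewrite -natrM muln2 -natrD odd_double_half.
have -> : Num.ceil (a%:~R / 2 : rat) = (uphalf a)%:Z.
  apply: ceil_def; rewrite uphalf_half PoszD a2 !rmorphB !rmorphD /=.
  by case: (odd a); rewrite /=; lra.
have -> : Num.floor (a%:~R / 2 : rat) = (a./2)%:Z.
  by apply: floor_def; rewrite a2 !rmorphD /=; case: (odd a); rewrite /=; lra.
by congr (nat_of_bool _)%:R; congr andb; lia.
Qed.

Lemma even_v01 m (R : 'rV[int]_m.+2) i : even_v R 0 i = 0 \/ even_v R 0 i = 1.
Proof. by rewrite mxE; apply: bool01. Qed.

(** For even a the two summands coincide; for odd a they differ at the single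
    index a./2, which makes the number of ones right for either parity. *)
Lemma even_v_pair h (R : 'rV[int]_(h + h).+2) (a : nat) (i : 'I_h) :
    R 0 ord0 = a%:Z -> (a <= h)%N ->
  let j := inner (lshift h i) in
  even_v R 0 j + even_v R 0 (rev_ord j) =
    (uphalf a <= i)%N%:R + (a./2 <= i)%N%:R.
Proof.
move=> Ra ah j; rewrite !(even_vE _ Ra).
have jE : j = i.+1 :> nat by rewrite innerE.
have rjE : rev_ord j = (h + h - i)%N :> nat.
  by rewrite rev_inner innerE /=; have := ltn_ord i; lia.
rewrite jE rjE; have := ltn_ord i; move: (nat_of_ord i) => k kh.
have -> : (k.+1 + a./2 <= h + h)%N = true by lia.
have -> : (uphalf a < h + h - k)%N = true by lia.
by rewrite andbT; congr (_ + (nat_of_bool _)%:R); lia.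
Qed.

Lemma sum_even_v_pair h k a : (k <= h)%N ->
  \sum_(i < h | (i < k)%N) ((uphalf a <= i)%N%:R + (a./2 <= i)%N%:R) =
    (k.*2 - a)%N%:Z.
Proof.
by move=> kh; rewrite big_split /= !sum_indicator_ge //; lia.
Qed.

(** Each outer vertex beats the inner vertices where [even_v], read in one
    direction or the other, vanishes; [even_v] has 2h - a ones among the 2h
    inner indices. *)
Lemma score_add_border h (R : 'rV[int]_(h + h).+2) (a : nat) M :
    palindromic R -> R 0 ord0 = a%:Z -> (a <= h)%N ->
    score_vector M = even_residual R ->
  score_vector (add_border (even_v R) M) = R.
Proof.
move=> R_pal Ra ah /rowP scoreM.
have sum_v : \sum_(i < h + h) (1 - even_v R 0 (inner i)) = a%:Z.
  rewrite sum_half; under eq_bigr do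
    rewrite addrACA -opprD -rev_inner (even_v_pair _ Ra ah).
  rewrite sumrB sumr_const card_ord.
  have := @sum_even_v_pair h h a (leqnn h); rewrite sum_prefix_full => ->.
  by lia.
have sum_v_rev : \sum_(i < h + h) (1 - even_v R 0 (rev_ord (inner i))) = a%:Z.
  by rewrite -sum_v [RHS](reindex_inj rev_ord_inj);
    under [RHS]eq_bigr do rewrite -rev_inner.
apply/rowP => i; rewrite mxE sum_border.
case: (borderP i) => [||b].
- rewrite !mxE !uninner0 !uninner_max addr0 add0r Ra -sum_v_rev.
  by apply: eq_bigr => k _; rewrite mxE uninner0 uninner_inner.
- rewrite !mxE !uninner0 !uninner_max addr0 add0r -rev_ord0 -R_pal Ra -sum_v rev_ord0.
  by apply: eq_bigr => k _; rewrite mxE uninner_max uninner_inner.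
- rewrite add_border_inner_first add_border_inner_last.
  under eq_bigr do rewrite mxE !uninner_inner.
  have := scoreM b; rewrite [RHS]mxE mxE => ->.
  set x := even_v R 0 _; set y := even_v R 0 _; set z := R 0 _; lia.
Qed.

(** * Feasibility of the residual vectors *)

Definition prefix_sum n (R : 'rV[int]_n) (k : nat) : int :=
  \sum_(i < n | (i < k)%N) R 0 i.

(** The hypothesis of the theorem over the integers; the truncation in [k.-1]
    is harmless because of the factor [k]. *)
Definition even_feasible n (R : 'rV[int]_n) : Prop :=
  [/\ palindromic R, nondecreasing_half R,
      forall k, (k <= n./2)%N -> (k * k.-1)%N%:Z <= prefix_sum R k
    & prefix_sum R n./2 = (n./2 * n./2.-1)%N%:Z].

(** Here 2m is the middle score r, which is even because the first half sums to
    the integer h(h-1) + (h - r/2).  The truncated k - m is the positive part of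
    k - r/2. *)
Definition odd_feasible n (R : 'rV[int]_n) : Prop :=
  [/\ palindromic R, nondecreasing_half R
    & exists m : nat,
      [/\ (m <= n./2)%N,
          forall c : 'I_n, c = n./2 :> nat -> R 0 c = (m.*2)%:Z,
          forall k, (k <= n./2)%N ->
            (k * k.-1 + (k - m))%N%:Z <= prefix_sum R k
        & prefix_sum R n./2 = (n./2 * n./2.-1 + (n./2 - m))%N%:Z]].

Definition feasible n (R : 'rV[int]_n) : Prop :=
  if odd n then odd_feasible R else even_feasible R.

(** The first k entries after sorting come from some k-subset of the first
    half, which is why prefix bounds before sorting do not suffice and
    [subset_sums_ge] is called for. *)
Lemma sorted_residual_feasible h (X : 'rV[int]_(h + h)) (r : 'I_h -> int)
    (s : 'S_h) :
    palindromic X ->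
    (forall i j : 'I_h, (i <= j)%N -> r i <= r j) ->
    (forall i, X 0 (lshift h i) <= r i <= X 0 (lshift h i) + 2) ->
    (forall k, (k <= h)%N ->
       (k * k.-1)%N%:Z <= \sum_(i < h | (i < k)%N) X 0 (lshift h i)) ->
    \sum_i X 0 (lshift h i) = (h * h.-1)%N%:Z ->
    nondecreasing_half (X *m (block_th (perm_mx s))^T) ->
  feasible (X *m (block_th (perm_mx s))^T).
Proof.
move=> X_pal r_mono r_X prefix_ge total; rewrite block_th_perm => X_sorted.
rewrite /feasible oddD addbb /even_feasible half_addnn.
have sumE k : (k <= h)%N -> prefix_sum (X *m (perm_mx (sym_perm s))^T) k =
    \sum_(i < h | (i < k)%N) X 0 (lshift h (s i)).
  move=> kh; rewrite /prefix_sum (sum_prefix (g := @lshift h h)) ?kh ?leq_addr //.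
  by apply: eq_bigr => i _; rewrite mul_row_tr_perm sym_perm_lshift.
split=> // [i|k kh|].
- by rewrite !mul_row_tr_perm sym_perm_rev -X_pal.
- pose S := s @: [set i : 'I_h | (i < k)%N].
  have cardS : #|S| = k by rewrite card_imset ?card_prefix //; apply: perm_inj.
  rewrite -{1 2}cardS sumE //.
  apply: le_trans (subset_sums_ge r_mono r_X prefix_ge S) _.
  rewrite big_imset /=; last by move=> i j _ _; apply: perm_inj.
  by under eq_bigl do rewrite inE.
- rewrite sumE // sum_prefix_full -total.
  by rewrite [RHS](reindex_inj (@perm_inj _ s)).
Qed.

(** The term (k - m)^+ in the odd hypothesis is the prefix sum of [odd_v], so
    the prefix sums of the residual satisfy the even condition. *)
Lemma odd_residual_feasible h (R : 'rV[int]_(h + h).+1) (s : 'S_h) :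
    let R' := odd_residual R *m (block_th (perm_mx s))^T in
  feasible R -> nondecreasing_half R' -> feasible R'.
Proof.
rewrite /feasible /= oddD addbb /= /odd_feasible /= uphalf_addnn.
case=> R_pal R_mono [m [mh Rmid R_ge R_total]].
have {}Rmid := Rmid (mid h) (val_mid h).
pose r i := R 0 (lift (mid h) (lshift h i)).
have XE i : odd_residual R 0 (lshift h i) = r i - (m <= i)%N%:R.
  by rewrite odd_residualE // (odd_v_lshift _ Rmid).
have sumE k : (k <= h)%N -> \sum_(i < h | (i < k)%N)
    odd_residual R 0 (lshift h i) = prefix_sum R k - (k - m)%N%:Z.
  move=> kh; under eq_bigr do rewrite XE.
  rewrite sumrB sum_indicator_ge // /prefix_sum.
  rewrite (sum_prefix (g := fun i : 'I_h => lift (mid h) (lshift h i))) //.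
    exact: lift_mid_lshift.
  by rewrite kh; lia.
move=> sorted.
have := sorted_residual_feasible (r := r) _ _ _ _ _ sorted.
rewrite /feasible oddD addbb; apply.
- by move=> i; rewrite !odd_residualE // lift_mid_rev -R_pal -odd_v_pal.
- move=> i j ij; apply: R_mono; rewrite !lift_mid_lshift //.
  by rewrite /= uphalf_addnn.
- by move=> i; rewrite XE; case: leqP => _; lia.
- by move=> k kh; rewrite sumE //; have := R_ge k kh; lia.
- by rewrite -sum_prefix_full sumE // R_total; lia.
Qed.

Lemma prefix_sum_border h (R : 'rV[int]_(h + h).+2) k : (k <= h)%N ->
  prefix_sum R k.+1 =
    R 0 ord0 + \sum_(i < h | (i < k)%N) R 0 (inner (lshift h i)).
Proof.
move=> kh; rewrite /prefix_sum.
pose g (i : 'I_h.+1) : 'I_(h + h).+2 := inord i.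
have gE i : g i = i :> nat by rewrite inordK; have := ltn_ord i; lia.
rewrite (sum_prefix (g := g)) //; last by rewrite ltnS kh; lia.
rewrite big_mkcond big_ord_recl -big_mkcond /=.
congr (R 0 _ + _); first by apply: ord_inj; rewrite gE.
apply: eq_bigr => i _; congr (R 0 _); apply: ord_inj.
by rewrite gE innerE lift0.
Qed.

Lemma first_le_inner h (R : 'rV[int]_(h + h).+2) (i : 'I_h) :
  nondecreasing_half R -> R 0 ord0 <= R 0 (inner (lshift h i)).
Proof. by apply=> //; rewrite innerE /= half_addnn ltnS. Qed.

(** The first score is at most the average h of the first half, so the ones of
    the two copies of v fill the end of that half without being cut off by its
    upper bound. *)
Lemma even_feasible_first h (R : 'rV[int]_(h + h).+2) : feasible R ->
  exists2 a : nat, R 0 ord0 = a%:Z & (a <= h)%N.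
Proof.
rewrite /feasible /= negbK oddD addbb /even_feasible /= half_addnn.
case=> R_pal R_mono R_ge R_total.
have := R_ge 1%N isT; rewrite prefix_sum_border // big_pred0 // addr0 => R0_ge0.
have [a Ra] : exists a : nat, R 0 ord0 = a%:Z.
  by exists (absz (R 0 ord0)); lia.
exists a => //; move: R_total; rewrite prefix_sum_border // sum_prefix_full Ra.
set S := \sum_i _; have : a%:Z *+ h <= S.
  rewrite -[X in _ *+ X]card_ord -sumr_const; apply: ler_sum => i _.
  by rewrite -Ra first_le_inner.
by nia.
Qed.

(** With a the first score, the k entries after it lose (2k - a)^+.  If a <= 2k,
    what remains is at least (k+1)k - a - (2k - a) = k(k-1); if 2k < a, nothing
    is lost and the k entries are at least a each. *)
Lemma even_residual_feasible h (R : 'rV[int]_(h + h).+2) (s : 'S_h) :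
    let R' := even_residual R *m (block_th (perm_mx s))^T in
  feasible R -> nondecreasing_half R' -> feasible R'.
Proof.
move=> R' R_feas; have [a Ra ah] := even_feasible_first R_feas.
move: R_feas; rewrite /feasible /= negbK oddD addbb /even_feasible /=.
rewrite half_addnn => -[R_pal R_mono R_ge R_total] sorted.
pose r i := R 0 (inner (lshift h i)).
have XE i : even_residual R 0 (lshift h i) =
    r i - ((uphalf a <= i)%N%:R + (a./2 <= i)%N%:R).
  by rewrite mxE -(even_v_pair _ Ra ah); rewrite opprD addrA.
have r_mono (i j : 'I_h) : (i <= j)%N -> r i <= r j.
  move=> ij; apply: R_mono; rewrite !innerE //=.
  by rewrite half_addnn; have := ltn_ord j; lia.
have r_ge i : a%:Z <= r i by rewrite -Ra first_le_inner.
have sumE k : (k <= h)%N -> prefix_sum R k.+1 =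
    a%:Z + \sum_(i < h | (i < k)%N) r i.
  by move=> kh; rewrite prefix_sum_border // Ra.
have residual_sumE k : (k <= h)%N -> \sum_(i < h | (i < k)%N)
    even_residual R 0 (lshift h i) = prefix_sum R k.+1 - a%:Z - (k.*2 - a)%N%:Z.
  move=> kh; under eq_bigr do rewrite XE.
  by rewrite sumrB sum_even_v_pair // sumE // [a%:Z + _]addrC addrK.
have := sorted_residual_feasible (r := r) _ r_mono _ _ _ sorted.
rewrite /feasible oddD addbb /even_feasible half_addnn; apply.
- move=> i; rewrite !mxE -rev_inner -R_pal rev_ordK; lia.
- by move=> i; rewrite XE; case: leqP => _; case: leqP => _; lia.
- move=> k kh; rewrite residual_sumE //.
  have [ak|ka] := leqP a k.*2.
    by have := R_ge k.+1 kh; rewrite !PoszM_pred; nia.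
  rewrite sumE //.
  have : a%:Z *+ k <= \sum_(i < h | (i < k)%N) r i.
    rewrite -[X in _ *+ X](card_prefix kh) -sumr_const.
    under eq_bigl do rewrite inE.
    by apply: ler_sum.
  by rewrite PoszM_pred; nia.
- by rewrite -sum_prefix_full residual_sumE // R_total PoszM_pred; nia.
Qed.

(** * Runs of the algorithm *)

(** Induction on the run rather than on the order: the two recursive
    constructors have orders of different shapes, and this avoids inverting a
    run at a given order. *)
Lemma alg_correct n (R : 'rV[int]_n) T : skew_hankel_alg R T -> feasible R ->
  skew_hankel_tournament T /\ score_vector T = R.
Proof.
elim=> {n R T} [R|h R P T Q R' /is_perm_mxP[s sE] R'_mono _ IH|
                h R P T Q R' /is_perm_mxP[s sE] R'_mono _ IH] R_feas.
- split; first by split; case.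
  by apply/rowP; case.
- have R'_feas : feasible R'.
    by move: R'_mono; rewrite /R' /Q sE; apply: odd_residual_feasible.
  have [T_ok T_score] := IH R'_feas.
  move: R_feas; rewrite /feasible /= oddD addbb /= /odd_feasible /=.
  rewrite uphalf_addnn => -[R_pal _ [m [mh Rmid _ _]]].
  split.
    apply: tournament_insert_middle; [exact: odd_v01|exact: odd_v_pal|].
    by rewrite /Q sE; apply: tournament_conj.
  apply: (score_insert_middle R_pal mh); first exact/Rmid/val_mid.
  by move: T_score; rewrite /R' /Q sE; apply: score_conj.
- have R'_feas : feasible R'.
    by move: R'_mono; rewrite /R' /Q sE; apply: even_residual_feasible.
  have [T_ok T_score] := IH R'_feas.
  have [a Ra ah] := even_feasible_first R_feas.
  have R_pal : palindromic R.
    by move: R_feas; rewrite /feasible /= negbK oddD addbb /= => -[].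
  split.
    apply: tournament_add_border; first exact: even_v01.
    by rewrite /Q sE; apply: tournament_conj.
  apply: (score_add_border R_pal Ra ah).
  by move: T_score; rewrite /R' /Q sE; apply: score_conj.
Qed.

(** The residual and v are defined for every input, so a run can only get stuck
    for want of a sorting permutation. *)
Lemma alg_has_run n (R : 'rV[int]_n) :
  exists T : 'M[int]_n, skew_hankel_alg R T.
Proof.
have [k] := ubnP n; elim: k n R => // k IH n R nk.
have := odd_double_half n; case: (odd n) => /= [|].
- rewrite add1n -addnn; move: n./2 => h nE; case: n / nE in R nk *.
  have [s s_sorts] := exists_sorting_block (odd_residual R).
  have [//|T T_alg] := IH _ (odd_residual R *m (block_th (perm_mx s))^T).
  by eexists; apply: alg_odd T_alg => //; apply: perm_mx_is_perm.
- rewrite add0n; case: n./2 => [|h].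
    by rewrite double0 => nE; case: n / nE in R nk *; exists 0; apply: alg_empty.
  rewrite doubleS -addnn => nE; case: n / nE in R nk *.
  have [s s_sorts] := exists_sorting_block (even_residual R).
  have [|T T_alg] := IH _ (even_residual R *m (block_th (perm_mx s))^T).
    exact: ltnW.
  by eexists; apply: alg_even T_alg => //; apply: perm_mx_is_perm.
Qed.

Lemma landau_boundE k : k%:R * (k%:R - 1) = (k * k.-1)%N%:Z%:~R :> rat.
Proof. by rewrite PoszM_pred rmorphM rmorphB. Qed.

Lemma prefix_sum0 n (R : 'rV[int]_n) : prefix_sum R 0 = 0.
Proof. exact: big_pred0. Qed.

Lemma even_hyp_feasible n (R : 'rV[int]_n) :
    palindromic R -> nondecreasing_half R ->
    partial_sums_ge R (fun k => k%:R * (k%:R - 1)) ->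
  even_feasible R.
Proof.
move=> R_pal R_mono R_sums.
split=> // [[|k] kn|].
- by rewrite prefix_sum0.
- by have [+ _] := R_sums k.+1 kn; rewrite landau_boundE ler_int.
- have [h0|n_gt0] := posnP n./2; first by rewrite h0 prefix_sum0.
  have [_ /(_ erefl)] := R_sums n./2 (introT andP (conj n_gt0 (leqnn _))).
  by rewrite landau_boundE => /intr_inj.
Qed.

(** The upper bound on the middle score makes the positive part at the half
    equal to its argument, and then equality there forces an even middle
    score. *)
Lemma odd_hyp_feasible n (R : 'rV[int]_n) : odd n ->
    (forall i, 0 <= R 0 i) -> palindromic R -> nondecreasing_half R ->
    (forall c : 'I_n, c = n./2 :> nat ->
     partial_sums_ge R
       (fun k => k%:R * (k%:R - 1) + pospart (k%:R - (R 0 c)%:~R / 2))) ->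
    (forall c : 'I_n, c = n./2 :> nat -> R 0 c <= n%:Z - 1) ->
  odd_feasible R.
Proof.
move=> n_odd R_ge0 R_pal R_mono R_sums R_mid.
have nE : n = (n./2).*2.+1 by rewrite -[LHS]odd_double_half n_odd.
have cn : (n./2 < n)%N by lia.
pose c := Ordinal cn.
have {}R_sums := R_sums c erefl; have {}R_mid := R_mid c erefl.
have Rc_ge0 := R_ge0 c.
have [m Rc mn] : exists2 m : nat, R 0 c = (m.*2)%:Z & (m <= n./2)%N.
  have [h0|n_gt0] := posnP n./2; first by exists 0%N => //; lia.
  have [_ /(_ erefl)] := R_sums n./2 (introT andP (conj n_gt0 (leqnn _))).
  have Rc_le : (R 0 c)%:~R / 2 <= n./2%:R :> rat.
    have : (R 0 c)%:~R <= (n./2.*2)%:Z%:~R :> rat by rewrite ler_int; lia.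
    by rewrite -muln2 PoszM rmorphM /=; lra.
  rewrite landau_boundE /pospart max_r; last by rewrite subr_ge0.
  move=> sumE.
  have : (R 0 c)%:~R =
      (2 * ((n./2 * n./2.-1)%N%:Z + n./2%:Z - prefix_sum R n./2))%:~R :> rat.
    rewrite !(rmorphM, rmorphB, rmorphD) /=.
    move: sumE; rewrite /partial_sum -/(prefix_sum R n./2) => ->.
    by lra.
  move=> /intr_inj; set x := _ - prefix_sum _ _ => RcE.
  by exists (absz x); lia.
have posE k : pospart (k%:R - (R 0 c)%:~R / 2) = (k - m)%N%:Z%:~R.
  have -> : k%:R - (R 0 c)%:~R / 2 = (k%:Z - m%:Z)%:~R :> rat.
    by rewrite Rc -muln2 PoszM rmorphB rmorphM /=; lra.
  rewrite /pospart; have [km|mk] := leqP k m.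
    have -> : (k - m)%N = 0%N by lia.
    by apply: max_l; rewrite lerz0; lia.
  have -> : (k - m)%N%:Z = k%:Z - m%:Z by lia.
  by apply: max_r; rewrite ler0z; lia.
split=> //; exists m; split=> // [d dE|[|k] kn|].
- by rewrite -Rc; congr (R 0 _); apply: ord_inj.
- by rewrite prefix_sum0.
- have [+ _] := R_sums k.+1 kn.
  by rewrite landau_boundE posE -rmorphD ler_int -PoszD.
- have [h0|n_gt0] := posnP n./2; first by rewrite h0 prefix_sum0.
  have [_ /(_ erefl)] := R_sums n./2 (introT andP (conj n_gt0 (leqnn _))).
  by rewrite landau_boundE posE -rmorphD -PoszD => /intr_inj.
Qed.

Theorem theorem26 (n : nat) (R : 'rV[int]_n)
  (R_ge0 : forall i, 0 <= R 0 i)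
  (R_pal : palindromic R)
  (R_mono : nondecreasing_half R)
  (R_even : ~~ odd n ->
     partial_sums_ge R (fun k => k%:R * (k%:R - 1)))
  (R_odd : odd n -> forall c : 'I_n, c = n./2 :> nat ->
     partial_sums_ge R
       (fun k => k%:R * (k%:R - 1) + pospart (k%:R - (R 0 c)%:~R / 2)))
  (R_mid : odd n -> forall c : 'I_n, c = n./2 :> nat -> R 0 c <= n%:Z - 1) :
  (exists T : 'M[int]_n, skew_hankel_alg R T) /\
  (forall T : 'M[int]_n, skew_hankel_alg R T ->
     skew_hankel_tournament T /\ score_vector T = R).
Proof.
split=> [|T T_alg]; first exact: alg_has_run.
apply: alg_correct T_alg _; rewrite /feasible.
have [n_odd|n_even] := boolP (odd n).
  exact: odd_hyp_feasible (R_odd n_odd) (R_mid n_odd).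
exact: even_hyp_feasible (R_even n_even).
Qed.
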